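(* The elements $A^iB^jC^k\alpha^r\beta^s\gamma^t$ with $i,j,k,r,s,t\geq 0$ form a basis for the $\mathbb F$-vector space $\Delta$.
   Context: Let $\mathbb F$ be a field and fix a nonzero $q\in\mathbb F$ with $q^4\neq 1$. The universal Askey--Wilson algebra $\Delta$ is the associative $\mathbb F$-algebra with 1 with generators $A,B,C$ subject to the relations that each of $A+\frac{qBC-q^{-1}CB}{q^2-q^{-2}}$, $B+\frac{qCA-q^{-1}AC}{q^2-q^{-2}}$, $C+\frac{qAB-q^{-1}BA}{q^2-q^{-2}}$ is central; $\alpha,\beta,\gamma$ denote these three central elements (in order) each multiplied by $q+q^{-1}$. *)

(* Defs.v *)
From HB Require Import structures.
From mathcomp Require Import all_boot all_algebra.
From mathcomp Require Import monalg.
Set Implicit Arguments. Unset Strict Implicit. Unset Printing Implicit Defensive.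
Import GRing.Theory.
Local Open Scope ring_scope.

(* The free associative F-algebra with 1 on three generators A, B, C:
   linear combinations of words over 'I_3, with concatenation product. *)
Definition freeAlg (F : fieldType) := {malg F[{fmonom 'I_3}]}.

Section UAW.
Variables (F : fieldType) (q : F).

Definition gen (i : 'I_3) : freeAlg F := << fmu i >>.
Definition gA : freeAlg F := gen (@Ordinal 3 0 isT).
Definition gB : freeAlg F := gen (@Ordinal 3 1 isT).
Definition gC : freeAlg F := gen (@Ordinal 3 2 isT).

Definition awX (x y z : freeAlg F) : freeAlg F :=
  x + (q ^+ 2 - q ^- 2)^-1 *: (q *: (y * z) - q^-1 *: (z * y)).

Definition alpha : freeAlg F := (q + q^-1) *: awX gA gB gC.
Definition beta  : freeAlg F := (q + q^-1) *: awX gB gC gA.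
Definition gamma : freeAlg F := (q + q^-1) *: awX gC gA gB.

(* Defining relators of Delta: each of the three elements commutes with
   each generator (equivalently, is central in the quotient algebra). *)
Definition relator (k : 'I_3) (i : 'I_3) : freeAlg F :=
  let X := [:: awX gA gB gC; awX gB gC gA; awX gC gA gB]`_k in
  X * gen i - gen i * X.

(* The two-sided ideal J of the free algebra generated by the relators;
   Delta = freeAlg F / J. *)
Definition awIdeal (x : freeAlg F) : Prop :=
  exists s : seq (freeAlg F * ('I_3 * 'I_3) * freeAlg F),
    x = \sum_(t <- s) t.1.1 * relator t.1.2.1 t.1.2.2 * t.2.

Definition expo := (nat * nat * nat * nat * nat * nat)%type.

Definition pbw (e : expo) : freeAlg F :=
  let: (i, j, k, r, s, t) := e in
  gA ^+ i * gB ^+ j * gC ^+ k * alpha ^+ r * beta ^+ s * gamma ^+ t.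

End UAW.

(* Main.v *)
Require Import Defs.
From HB Require Import structures.
From mathcomp Require Import all_boot all_algebra.
From mathcomp Require Import monalg ring.
Import GRing.Theory.
Local Open Scope ring_scope.
Set Implicit Arguments. Unset Strict Implicit. Unset Printing Implicit Defensive.

(** Spanning: the definitions of alpha, beta, gamma rewrite BA, CA and CB as
ordered terms plus terms of lower degree, so left multiplication by B and C
raises the filtration by degree in A, B, C by at most one.

Independence: Delta acts on the free module V with basis A^i B^j over the
polynomial ring S = F[c, alpha, beta, gamma], where c stands for right
multiplication by C.  The operators B and C on V are defined by recursion on the
degree in A so that the relations for BA and CA hold; the relation for CB is
imposed on A-degree 0, where it defines C, and propagates to all degrees.
Applying a monomial A^i B^j C^k alpha^r beta^s gamma^t to 1 returns
the corresponding commutative monomial. *)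

(** * Maps linear over a base ring, and removal of the constant term *)

Section ScalarLinear.
Variables (S U : comNzRingType) (iota : {rmorphism S -> U}).

(** Linearity is taken over the image of [iota] only: the operators below respect scalars of [S] but
    in general not the variables A and B. *)
Definition slin (f : U -> U) := forall s x y, f (iota s * x + y) = iota s * f x + f y.

Section Theory.
Variable f : U -> U.
Hypothesis f_lin : slin f.

Lemma slinD x y : f (x + y) = f x + f y.
Proof. by have := f_lin 1 x y; rewrite rmorph1 !mul1r. Qed.

Lemma slin0 : f 0 = 0.
Proof. by apply: (addrI (f 0)); rewrite -slinD !addr0. Qed.

Lemma slinM s x : f (iota s * x) = iota s * f x.
Proof. by rewrite -[iota s * x]addr0 f_lin slin0 addr0. Qed.

Lemma slinN x : f (- x) = - f x.
Proof. by apply: (addrI (f x)); rewrite -slinD !subrr slin0. Qed.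

End Theory.
End ScalarLinear.

Lemma size_XM_leq (R : comNzRingType) (p : {poly R}) : (size ('X * p)%R <= (size p).+1)%N.
Proof. by rewrite mulrC (leq_trans (size_polyMleq _ _)) // size_polyX addn2. Qed.

Lemma drop_polyXM (R : comNzRingType) (p : {poly R}) : drop_poly 1 ('X * p) = p.
Proof. by apply/polyP => i; rewrite coef_drop_poly coefXM addn1. Qed.

Lemma size_drop1 (R : comNzRingType) n (p : {poly R}) :
  (size p <= n.+1)%N -> (size (drop_poly 1 p) <= n)%N.
Proof. by move=> h; rewrite size_drop_poly leq_subLR add1n. Qed.

Lemma drop_polyDC (R : comNzRingType) (c : R) (p q : {poly R}) :
  drop_poly 1 (c%:P * p + q) = c%:P * drop_poly 1 p + drop_poly 1 q.
Proof. by apply/polyP => i; rewrite coef_drop_poly !(coefD, coefCM) !coef_drop_poly. Qed.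

Lemma drop_polyC1 (R : comNzRingType) (c : R) : drop_poly 1 c%:P = 0.
Proof. by apply/polyP => i; rewrite coef_drop_poly coefC coef0 addn1. Qed.

Definition polyCC (S : comNzRingType) : {rmorphism S -> {poly {poly S}}} := polyC \o polyC.

(** * The operators B and C on V, and the relation for CB *)

Section Representation.
(* [a], [b], [g] are (q - q^-1) times alpha, beta, gamma; [qi] is q^-1. *)
Variables (S : comNzRingType) (q qi c a b g : S).
Hypothesis qqi : q * qi = 1.

Local Notation k := (q ^+ 2 - qi ^+ 2).

Local Notation W := {poly S}.
Local Notation V := {poly {poly S}}.

(* C acts on a polynomial [w] in B as [C w = A (phi w) + psi w].  The recursion is
   forced by CB = q^2 BC - q a + q k A; the nested call terminates because [phi]
   lowers degrees. *)
Fixpoint phi_fuel (n : nat) (p : W) : W :=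
  if n is m.+1 then
    let r := drop_poly 1 p in
    (q ^+ 4)%:P * ('X * phi_fuel m r) + (q ^+ 3 * k)%:P * phi_fuel m (phi_fuel m r)
    + (q * k)%:P * r
  else 0.

Definition phi (p : W) : W := phi_fuel (size p) p.

Lemma phi_fuel_lin n : slin (polyC : {rmorphism S -> W}) (phi_fuel n).
Proof.
elim: n => [|n IH] s x y /=; first by rewrite mulr0 addr0.
by rewrite drop_polyDC !IH; ring.
Qed.

(** Each of the three terms has degree at most that of [r], the factor B being offset by the drop in
    the inner call. The bound holds for every fuel, so [phi_fuel_eq] can apply it to the argument of
    the nested call. *)
Lemma size_phi_fuel n m (p : W) :
  (size p <= m.+1)%N -> (size (phi_fuel n p) <= m)%N.
Proof.
elim: n m p => [|n IH] m p hp /=; first by rewrite size_poly0.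
have hr := size_drop1 hp.
have hC (s : S) (x : W) : (size x <= m)%N -> (size (s%:P * x)%R <= m)%N.
  by apply: leq_trans; rewrite mul_polyC size_scale_leq.
have hD (x y : W) : (size x <= m)%N -> (size y <= m)%N -> (size (x + y)%R <= m)%N.
  by move=> hx hy; rewrite (leq_trans (size_polyD _ _)) // geq_max hx.
(* For [m] zero the polynomial is constant and [r] vanishes; otherwise the bound on [r] has the
   successor form that the induction hypothesis asks for. *)
case: m hp hr hC hD => [|m] hp hr hC hD.
  move: hr; rewrite leqn0 size_poly_eq0 => /eqP ->.
  by rewrite !(slin0 (phi_fuel_lin n)) !mulr0 !addr0 size_poly0.
have h1 := IH _ _ hr.
apply: (hD); last exact: hC.
apply: (hD).
  apply: hC; rewrite mulrC; case: (eqVneq (phi_fuel n (drop_poly 1 p)) 0) => [->|nz].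
    by rewrite mul0r size_poly0.
  by rewrite size_mulX.
by apply: hC; apply: IH; rewrite (leq_trans h1) // leqW.
Qed.

Lemma phi_fuel_eq n m (p : W) : (size p <= n)%N -> (size p <= m)%N -> phi_fuel n p = phi_fuel m p.
Proof.
elim: n m p => [|n IH] m p.
  by rewrite leqn0 size_poly_eq0 => /eqP ->; rewrite (slin0 (phi_fuel_lin m)).
case: m => [|m] hn hm.
  by move: hm; rewrite leqn0 size_poly_eq0 => /eqP ->; rewrite (slin0 (phi_fuel_lin _)).
have hrn := size_drop1 hn; have hrm := size_drop1 hm.
rewrite /= -(IH m _ hrn hrm).
have hs l : (size (drop_poly 1 p) <= l)%N -> (size (phi_fuel n (drop_poly 1 p)) <= l)%N.
  by move=> hl; apply: size_phi_fuel; apply: leqW.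
by rewrite (IH m (phi_fuel n _)) ?hs.
Qed.

Lemma phiE n (p : W) : (size p <= n)%N -> phi p = phi_fuel n p.
Proof. by move=> h; exact: phi_fuel_eq. Qed.

Lemma phi_lin : slin (polyC : {rmorphism S -> W}) phi.
Proof.
(* A fuel large enough for all three arguments reduces the claim to [phi_fuel_lin]. *)
move=> s x y; pose n := maxn (size (s%:P * x + y)) (maxn (size x) (size y)).
rewrite !(@phiE n) ?phi_fuel_lin // /n; by rewrite !leq_max leqnn ?orbT.
Qed.

(** With [psiX] below, these are the coefficients of A and of 1 in the CB relation applied to a
    polynomial in B; [opCB_polyC] reassembles them. *)
Lemma phiX p :
  phi ('X * p) = (q ^+ 4)%:P * ('X * phi p) + (q ^+ 3 * k)%:P * phi (phi p) + (q * k)%:P * p.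
Proof.
rewrite (phiE (size_XM_leq p)) /= drop_polyXM -(phiE (leqnn _)) (@phiE (size p) (phi p)) //.
by apply: size_phi_fuel; apply: leqW.
Qed.

Lemma phiC s : phi s%:P = 0.
Proof. by rewrite (@phiE 1) /= ?drop_polyC1 ?mulr0 ?addr0 // size_polyC; case: (s != 0). Qed.

(** The A-free part of C on polynomials in B, again forced by CB. The last term makes C send 1 to
    the free parameter [c]. *)
Fixpoint psi_fuel (n : nat) (p : W) : W :=
  if n is m.+1 then
    let r := drop_poly 1 p in
    (q ^+ 2)%:P * ('X * psi_fuel m r) + (q ^+ 3 * k)%:P * psi_fuel m (phi r)
    - (q ^+ 3 * g)%:P * phi r - (q * a)%:P * r + c%:P * (p`_0)%:P
  else 0.

Definition psi (p : W) : W := psi_fuel (size p) p.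

Lemma psi_fuel_lin n : slin (polyC : {rmorphism S -> W}) (psi_fuel n).
Proof.
elim: n => [|n IH] s x y /=; first by rewrite mulr0 addr0.
by rewrite drop_polyDC coefD coefCM polyCD polyCM phi_lin !IH; ring.
Qed.

Lemma psi_fuel_eq n m (p : W) : (size p <= n)%N -> (size p <= m)%N -> psi_fuel n p = psi_fuel m p.
Proof.
elim: n m p => [|n IH] m p.
  by rewrite leqn0 size_poly_eq0 => /eqP ->; rewrite (slin0 (psi_fuel_lin m)).
case: m => [|m] hn hm.
  by move: hm; rewrite leqn0 size_poly_eq0 => /eqP ->; rewrite (slin0 (psi_fuel_lin _)).
have hrn := size_drop1 hn; have hrm := size_drop1 hm.
have hs l : (size (drop_poly 1 p) <= l)%N -> (size (phi (drop_poly 1 p)) <= l)%N.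
  by move=> hl; apply: size_phi_fuel; apply: leqW.
by rewrite /= !(IH m) ?hs.
Qed.

Lemma psiE n (p : W) : (size p <= n)%N -> psi p = psi_fuel n p.
Proof. by move=> h; exact: psi_fuel_eq. Qed.

Lemma psi_lin : slin (polyC : {rmorphism S -> W}) psi.
Proof.
move=> s x y; pose n := maxn (size (s%:P * x + y)) (maxn (size x) (size y)).
rewrite !(@psiE n) ?psi_fuel_lin // /n; by rewrite !leq_max leqnn ?orbT.
Qed.

Lemma psiX p :
  psi ('X * p) = (q ^+ 2)%:P * ('X * psi p) + (q ^+ 3 * k)%:P * psi (phi p)
    - (q ^+ 3 * g)%:P * phi p - (q * a)%:P * p.
Proof.
rewrite (psiE (size_XM_leq p)) /= drop_polyXM coefXM /= mulr0 addr0 -(psiE (leqnn _)).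
by rewrite (@psiE (size p) (phi p)) //; apply: size_phi_fuel; apply: leqW.
Qed.

Lemma psiC s : psi s%:P = c%:P * s%:P.
Proof.
rewrite (@psiE 1) /= ?drop_polyC1 ?coefC ?(slin0 phi_lin) ?mulr0 ?subr0 ?add0r //.
by rewrite size_polyC; case: (s != 0).
Qed.

Local Notation cst := (@polyCC S).

(** B and C are computed together, because BA = q^2 AB + qkC - qg and CA = q^-2 AC - q^-1 kB + q^-1
    b each call for both on the quotient [r] of [v] by A. The terms in the constant coefficient of
    [v] give the action in A-degree 0. *)
Fixpoint opBC_fuel (n : nat) (v : V) : V * V :=
  if n is m.+1 then
    let r := drop_poly 1 v in
    let: (B, C) := opBC_fuel m r in
    (cst (q ^+ 2) * ('X * B) + cst (q * k) * C - cst (q * g) * r + ('X * v`_0)%:P,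
     cst (qi ^+ 2) * ('X * C) - cst (qi * k) * B + cst (qi * b) * r
     + 'X * (phi v`_0)%:P + (psi v`_0)%:P)
  else (0, 0).

Definition opB (v : V) : V := (opBC_fuel (size v) v).1.
Definition opC (v : V) : V := (opBC_fuel (size v) v).2.

Lemma opBC_fuel_lin n s x y :
  opBC_fuel n (cst s * x + y) =
    (cst s * (opBC_fuel n x).1 + (opBC_fuel n y).1,
     cst s * (opBC_fuel n x).2 + (opBC_fuel n y).2).
Proof.
elim: n x y => [|n IH] x y /=; first by rewrite mulr0 addr0.
rewrite drop_polyDC IH coefD coefCM /= phi_lin psi_lin.
case: (opBC_fuel n (drop_poly 1 x)) => Bx Cx; case: (opBC_fuel n (drop_poly 1 y)) => By Cy /=.
by rewrite mulrDr mulrCA !polyCD !polyCM; congr pair; ring.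
Qed.

Lemma opBC_fuel0 n : opBC_fuel n 0 = (0, 0).
Proof.
elim: n => //= n IH; rewrite -[X in drop_poly 1 X](polyC0) drop_polyC1 IH coef0.
by rewrite (slin0 phi_lin) (slin0 psi_lin) !polyC0 !mulr0 !(addr0, subr0).
Qed.

Lemma opBC_fuel_eq n m (v : V) : (size v <= n)%N -> (size v <= m)%N -> opBC_fuel n v = opBC_fuel m v.
Proof.
elim: n m v => [|n IH] m v.
  by rewrite leqn0 size_poly_eq0 => /eqP ->; rewrite !opBC_fuel0.
case: m => [|m] hn hm.
  by move: hm; rewrite leqn0 size_poly_eq0 => /eqP ->; rewrite !opBC_fuel0.
by rewrite /= (IH m) // size_drop1.
Qed.

Lemma opB_lin : slin cst opB.
Proof.
move=> s x y; pose n := maxn (size (cst s * x + y)) (maxn (size x) (size y)).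
by rewrite /opB !(@opBC_fuel_eq (size _) n) ?opBC_fuel_lin // /n !leq_max leqnn ?orbT.
Qed.

Lemma opC_lin : slin cst opC.
Proof.
move=> s x y; pose n := maxn (size (cst s * x + y)) (maxn (size x) (size y)).
by rewrite /opC !(@opBC_fuel_eq (size _) n) ?opBC_fuel_lin // /n !leq_max leqnn ?orbT.
Qed.

Lemma opBC_XM (v : V) : opBC_fuel (size ('X * v)) ('X * v) =
  (cst (q ^+ 2) * ('X * opB v) + cst (q * k) * opC v - cst (q * g) * v,
   cst (qi ^+ 2) * ('X * opC v) - cst (qi * k) * opB v + cst (qi * b) * v).
Proof.
rewrite (opBC_fuel_eq (leqnn _) (size_XM_leq v)) /= drop_polyXM coefXM /= /opB /opC.
case: (opBC_fuel (size v) v) => B C /=.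
by rewrite (slin0 phi_lin) (slin0 psi_lin) !polyC0 !mulr0 !addr0.
Qed.

Lemma opB_XM (v : V) :
  opB ('X * v) = cst (q ^+ 2) * ('X * opB v) + cst (q * k) * opC v - cst (q * g) * v.
Proof. by rewrite /opB opBC_XM. Qed.

Lemma opC_XM (v : V) :
  opC ('X * v) = cst (qi ^+ 2) * ('X * opC v) - cst (qi * k) * opB v + cst (qi * b) * v.
Proof. by rewrite /opC opBC_XM. Qed.

Lemma opBC_polyC (w : W) :
  opBC_fuel (size (w%:P)) w%:P = (('X * w)%:P, 'X * (phi w)%:P + (psi w)%:P).
Proof.
rewrite (@opBC_fuel_eq _ 1) //; last by rewrite size_polyC; case: (w != 0).
by rewrite /= drop_polyC1 coefC /= !mulr0 ?oppr0 ?(addr0, add0r) .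
Qed.

Lemma opB_polyC (w : W) : opB w%:P = ('X * w)%:P.
Proof. by rewrite /opB opBC_polyC. Qed.

Lemma opC_polyC (w : W) : opC w%:P = 'X * (phi w)%:P + (psi w)%:P.
Proof. by rewrite /opC opBC_polyC. Qed.

Lemma opCB_polyC (w : W) :
  opC (opB w%:P) = cst (q ^+ 2) * opB (opC w%:P) - cst (q * a) * w%:P + cst (q * k) * ('X * w%:P).
Proof.
rewrite opB_polyC !opC_polyC (slinD opB_lin) opB_XM !opB_polyC opC_polyC phiX psiX.
rewrite /=.
rewrite !(polyCD, polyCM, polyCN) /=.
ring.
Qed.

(* If the relation holds on v, then BA and CA turn it into the relation on Av. *)
Lemma opCB (v : V) :
  opC (opB v) = cst (q ^+ 2) * opB (opC v) - cst (q * a) * v + cst (q * k) * ('X * v).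
Proof.
elim/poly_ind: v => [|v w IH].
  by rewrite (slin0 opB_lin) (slin0 opC_lin) (slin0 opB_lin) !mulr0 subr0 addr0.
have DB := slinD opB_lin; have DC := slinD opC_lin.
have MB := slinM opB_lin; have MC := slinM opC_lin.
have NB := slinN opB_lin; have NC := slinN opC_lin.
rewrite mulrC !(DB, DC) opCB_polyC.
suff -> : opC (opB ('X * v)) = cst (q ^+ 2) * opB (opC ('X * v)) - cst (q * a) * ('X * v)
    + cst (q * k) * ('X * ('X * v)).
  by ring.
(* The terms in BBv, CCv, Bv and Cv agree on the two sides; what is left is A times the relation on
   v. *)
rewrite opB_XM opC_XM !(DB, DC, NB, NC, MB, MC) opB_XM opC_XM IH.
have qqi' : cst q * cst qi = 1 by rewrite -rmorphM qqi rmorph1.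
rewrite !(rmorphM, rmorphXn).
move: (cst q) (cst qi) qqi' => Q Qi h.
ring: h.
Qed.

End Representation.

(** * The free algebra: induction on words, and scalars *)

Section FreeAlgebra.
Variable F : fieldType.
Implicit Types x y : freeAlg F.

Lemma malg_monom_ind (P : freeAlg F -> Prop) :
    P 0 -> (forall x y, P x -> P y -> P (x + y)) -> (forall c m, P << c *g m >>) ->
  forall x, P x.
Proof. by move=> P0 PD PU x; rewrite (monalgE x); apply: big_ind. Qed.

Lemma gen_mulU i (c : F) (m : {fmonom 'I_3}) :
  gen F i * << c *g m >> = << c *g FMonom (i :: m) >>.
Proof.
rewrite /gen malgM_def fgmulUU mul1r; congr << _ *g _ >>.
by apply/eqP; rewrite fmP fmM fmU.
Qed.

Lemma scale_monom (c e : F) (m : {fmonom 'I_3}) : c *: << e *g m >> = << c * e *g m >>.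
Proof. by apply/malgP => k; rewrite mcoeffZ [X in _ * X]mcoeffU [RHS]mcoeffU mulrnAr. Qed.

(** Words grow on the left, to match both the action on V and the left multiplications of the
    spanning argument. *)
Lemma freeAlg_ind (P : freeAlg F -> Prop) :
    (forall x y, P x -> P y -> P (x + y)) -> (forall (c : F) x, P x -> P (c *: x)) ->
    P 1 -> (forall i x, P x -> P (gen F i * x)) ->
  forall x, P x.
Proof.
move=> PD PZ P1 Pg; apply: malg_monom_ind => // [|c m].
  by rewrite -(scale0r (1 : freeAlg F)); apply: PZ.
suff P1m : P << m >>.
  by rewrite -[c]mulr1 -scale_monom; apply: PZ.
case: m; elim=> [|i s IH].
  suff -> : << FMonom [::] >> = 1 :> freeAlg F by [].
  by congr << _ *g _ >>; apply/eqP; rewrite fmP fm1.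
by rewrite -[i :: s]/(i :: FMonom s) -gen_mulU; apply: Pg.
Qed.

(** Induction on [x] reduces to a generator times a weighted word, where both sides put the same
    coefficient on the same word. *)
Lemma freeAlg_scalerAr (c : F) x y : c *: (x * y) = x * (c *: y).
Proof.
elim/freeAlg_ind: x c y => [x x' hx hx'|d x hx||i x hx] c y.
- by rewrite !mulrDl scalerDr; congr (_ + _); [exact: hx | exact: hx'].
- by rewrite -!scalerAl -hx !scalerA mulrC.
- by rewrite !mul1r.
rewrite -!mulrA -hx; move: (x * y) => z {hx x y}.
elim/malg_monom_ind: z => [|z w hz hw|d m].
- by rewrite !(mulr0, scaler0).
- by rewrite mulrDr !scalerDr mulrDr; congr (_ + _); [exact: hz | exact: hw].
by rewrite [X in _ *: X = _]gen_mulU scale_monom [X in _ = _ * X]scale_monom [RHS]gen_mulU.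
Qed.

End FreeAlgebra.

(** * The action of the free algebra on V, trivial on the ideal *)

Section Action.
Variables (F : fieldType) (q : F).
Hypotheses (hq0 : q != 0) (hq4 : q ^+ 4 != 1).
Variables (S : comNzRingType) (iota : {rmorphism F -> S}) (c al be ga : S).

Local Notation V := {poly {poly S}}.
Local Notation d := (iota (q - q^-1)).
Local Notation cst := (@polyCC S).
Let fcst : {rmorphism F -> V} := cst \o iota.

Lemma iota_qqi : iota q * iota q^-1 = 1.
Proof. by rewrite -rmorphM divff // rmorph1. Qed.

Definition actB := opB (iota q) (iota q^-1) c (d * al) (d * be) (d * ga).
Definition actC := opC (iota q) (iota q^-1) c (d * al) (d * be) (d * ga).

Definition act_gen (i : 'I_3) (v : V) : V := nth 0 [:: 'X * v; actB v; actC v] i.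

Lemma act_gen_lin i : slin cst (act_gen i).
Proof.
case: i => -[|[|[|//]]] hi s x y; rewrite /act_gen /=.
- by ring.
- exact: opB_lin.
- exact: opC_lin.
Qed.

Definition act_word (v : V) (m : {fmonom 'I_3}) : V := foldr act_gen v m.

Lemma act_word_lin m : slin cst (act_word^~ m).
Proof.
move=> s x y; rewrite /act_word; elim: {m}(m : seq _) => //= i m ->.
exact: act_gen_lin.
Qed.

(** [mmap] serves here only as linear extension from words; compatibility with products is
    composition of operators, proved in [actM]. *)
Definition act (x : freeAlg F) (v : V) : V := mmap fcst (act_word v) x.

Lemma actDl x y v : act (x + y) v = act x v + act y v.
Proof. exact: mmapD. Qed.

Lemma actNl x v : act (- x) v = - act x v.
Proof. exact: mmapN. Qed.

Lemma act0l v : act 0 v = 0.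
Proof. exact: mmap0. Qed.

Lemma actU (e : F) m v : act << e *g m >> v = fcst e * act_word v m.
Proof. exact: mmapU. Qed.

Lemma act1 v : act 1 v = v.
Proof. by rewrite actU rmorph1 mul1r /act_word fm1. Qed.

Lemma actZ (e : F) x v : act (e *: x) v = fcst e * act x v.
Proof.
elim/malg_monom_ind: x => [|x y hx hy|f m].
- by rewrite scaler0 act0l mulr0.
- by rewrite scalerDr !actDl mulrDr; congr (_ + _).
by rewrite scale_monom [LHS]actU [X in _ = _ * X]actU rmorphM mulrA.
Qed.

Lemma act_lin x : slin cst (act x).
Proof.
move=> s u v; elim/malg_monom_ind: x => [|x y hx hy|e m].
- by rewrite !act0l; ring.
- by rewrite !actDl hx hy; ring.
by rewrite !actU act_word_lin; ring.
Qed.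

Lemma act_genM i x v : act (gen F i * x) v = act_gen i (act x v).
Proof.
elim/malg_monom_ind: x => [|x y hx hy|e m].
- by rewrite mulr0 !act0l (slin0 (act_gen_lin i)).
- by rewrite mulrDr !actDl (slinD (act_gen_lin i)); congr (_ + _).
by rewrite gen_mulU !actU (slinM (act_gen_lin i) (iota e)).
Qed.

Lemma actM x y v : act (x * y) v = act x (act y v).
Proof.
elim/freeAlg_ind: x => [x x' hx hx'|e x hx||i x hx].
- by rewrite mulrDl !actDl; congr (_ + _).
- by rewrite -scalerAl [LHS]actZ [RHS]actZ; congr (_ * _).
- by rewrite mul1r act1.
by rewrite -[in LHS]mulrA [LHS]act_genM [RHS]act_genM; congr act_gen.
Qed.

Lemma act_genE i v : act (gen F i) v = act_gen i v.
Proof. by rewrite -[gen F i]mulr1 act_genM act1. Qed.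


Lemma act_awX x y z v : act (awX q x y z) v =
  act x v + fcst (q ^+ 2 - q ^- 2)^-1 *
            (fcst q * act y (act z v) - fcst q^-1 * act z (act y v)).
Proof.
rewrite /awX actDl; congr (_ + _); rewrite [LHS]actZ; congr (_ * _).
by rewrite [LHS]actDl actNl; congr (_ - _); rewrite [LHS]actZ actM.
Qed.

Lemma fcst_qqi : fcst q * fcst q^-1 = 1.
Proof. by rewrite -rmorphM divff // rmorph1. Qed.

Lemma q2D_neq0 : q + q^-1 != 0.
Proof.
apply: contraNneq hq4 => h; have /eqP : q ^+ 2 = -1.
  by apply/eqP; rewrite -subr_eq0 opprK -(mulr0 q) -h mulrDr divff.
by move/eqP; rewrite (exprM q 2 2) => ->; rewrite sqrrN expr1n.
Qed.

Lemma q2B_neq0 : q ^+ 2 - q ^- 2 != 0.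
Proof.
apply: contraNneq hq4 => h; rewrite -subr_eq0 -(mulr0 (q ^+ 2)) -h mulrBr divff ?expf_neq0 //.
by rewrite -exprD.
Qed.

Lemma q2BE : q ^+ 2 - q ^- 2 = (q + q^-1) * (q - q^-1).
Proof. by rewrite -exprVn; ring. Qed.

(** Dividing the hypothesis by q^2 - q^-2 cancels the term in [x] and leaves the scalar [d * e] over
    q^2 - q^-2 = (q + q^-1)(q - q^-1). This is why the parameters of the operators carry the factor
    [d]. *)
Lemma act_awX_scalar x y z v (e : S) :
    fcst q * act y (act z v) - fcst q^-1 * act z (act y v) =
      cst (d * e) * v - fcst (q ^+ 2 - q ^- 2) * act x v ->
  act (awX q x y z) v = cst (iota (q + q^-1)^-1 * e) * v.
Proof.
move=> h; rewrite act_awX h mulrBr (mulrA _ _ (act x v)) -rmorphM mulVf ?q2B_neq0 //.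
rewrite rmorph1 mul1r addrC subrK mulrA; congr (_ * _).
rewrite -[fcst _]/(cst (iota _)) -rmorphM mulrA -rmorphM; congr (cst (iota _ * _)).
have := q2B_neq0; rewrite q2BE mulf_eq0 negb_or => /andP[_ hd].
by rewrite invfM -mulrA mulVf // mulr1.
Qed.

Lemma iota_q2B : fcst (q ^+ 2 - q ^- 2) = fcst q ^+ 2 - fcst q^-1 ^+ 2.
Proof. by rewrite -exprVn rmorphB !rmorphXn. Qed.

Lemma act_gA v : act (gA F) v = 'X * v. Proof. exact: act_genE. Qed.
Lemma act_gB v : act (gB F) v = actB v. Proof. exact: act_genE. Qed.
Lemma act_gC v : act (gC F) v = actC v. Proof. exact: act_genE. Qed.

Lemma act_awX_A v : act (awX q (gA F) (gB F) (gC F)) v = cst (iota (q + q^-1)^-1 * al) * v.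
Proof.
apply: act_awX_scalar; rewrite !act_gB !act_gC act_gA /actB /actC (opCB _ _ _ _ iota_qqi).
rewrite iota_q2B !(rmorphM cst, rmorphB cst, rmorphXn cst).
rewrite -![cst (iota q)]/(fcst q) -![cst (iota q^-1)]/(fcst q^-1).
move: (fcst q) (fcst q^-1) fcst_qqi => Q Qi h.
by ring: h.
Qed.

Lemma act_awX_B v : act (awX q (gB F) (gC F) (gA F)) v = cst (iota (q + q^-1)^-1 * be) * v.
Proof.
apply: act_awX_scalar; rewrite !act_gB !act_gC !act_gA /actB /actC opC_XM.
rewrite iota_q2B !(rmorphM cst, rmorphB cst, rmorphXn cst).
rewrite -![cst (iota q)]/(fcst q) -![cst (iota q^-1)]/(fcst q^-1).
move: (fcst q) (fcst q^-1) fcst_qqi => Q Qi h.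
by ring: h.
Qed.

Lemma act_awX_C v : act (awX q (gC F) (gA F) (gB F)) v = cst (iota (q + q^-1)^-1 * ga) * v.
Proof.
apply: act_awX_scalar; rewrite !act_gB !act_gC !act_gA /actB /actC opB_XM.
rewrite iota_q2B !(rmorphM cst, rmorphB cst, rmorphXn cst).
rewrite -![cst (iota q)]/(fcst q) -![cst (iota q^-1)]/(fcst q^-1).
move: (fcst q) (fcst q^-1) fcst_qqi => Q Qi h.
by ring: h.
Qed.

(** An element acting as a scalar of [S] commutes with the S-linear operator of any generator. *)
Lemma act_relator i j v : act (relator q i j) v = 0.
Proof.
have central x e : (forall u, act x u = cst e * u) -> act (x * gen F j - gen F j * x) v = 0.
  move=> hx; rewrite actDl actNl; apply/eqP; rewrite subr_eq0; apply/eqP.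
  rewrite [LHS]actM [RHS]actM [LHS]hx (hx v); symmetry.
  exact: (slinM (act_lin (gen F j))).
rewrite /relator; case: i => -[|[|[|//]]] hi.
- exact: central act_awX_A.
- exact: central act_awX_B.
- exact: central act_awX_C.
Qed.

Lemma act_awIdeal x v : awIdeal q x -> act x v = 0.
Proof.
case=> s ->; elim: s => [|t s IH]; first by rewrite big_nil act0l.
rewrite big_cons actDl IH addr0 [LHS]actM [LHS]actM act_relator.
exact: (slin0 (act_lin t.1.1)).
Qed.

Lemma act_scale_awX x (e : S) v :
  (forall u, act x u = cst (iota (q + q^-1)^-1 * e) * u) ->
  act ((q + q^-1) *: x) v = cst e * v.
Proof.
move=> hx; rewrite [LHS]actZ hx mulrA -[fcst _]/(cst (iota _)) -rmorphM mulrA -rmorphM divff ?q2D_neq0 //.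
by rewrite rmorph1 mul1r.
Qed.

Lemma act_alpha v : act (alpha q) v = cst al * v.
Proof. exact: act_scale_awX act_awX_A. Qed.

Lemma act_beta v : act (beta q) v = cst be * v.
Proof. exact: act_scale_awX act_awX_B. Qed.

Lemma act_gamma v : act (gamma q) v = cst ga * v.
Proof. exact: act_scale_awX act_awX_C. Qed.

Lemma act_scalar_expr x (e : S) n v :
  (forall u, act x u = cst e * u) -> act (x ^+ n) v = cst (e ^+ n) * v.
Proof.
move=> hx; elim: n => [|n IH]; first by rewrite !expr0 act1 rmorph1 mul1r.
by rewrite !exprS [LHS]actM hx IH mulrA -rmorphM.
Qed.

Lemma act_gA_expr n v : act (gA F ^+ n) v = 'X ^+ n * v.
Proof.
elim: n => [|n IH]; first by rewrite !expr0 act1 mul1r.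
by rewrite !exprS [LHS]actM act_gA IH mulrA.
Qed.

Lemma act_gB_expr n (w : {poly S}) : act (gB F ^+ n) w%:P = ('X ^+ n * w)%:P.
Proof.
elim: n => [|n IH]; first by rewrite !expr0 act1 mul1r.
by rewrite !exprS [LHS]actM act_gB IH /actB opB_polyC mulrA.
Qed.

Lemma act_gC_expr n (u : S) : act (gC F ^+ n) (cst u) = cst (c ^+ n * u).
Proof.
elim: n => [|n IH]; first by rewrite !expr0 act1 mul1r.
rewrite !exprS [LHS]actM act_gC IH /actC opC_polyC phiC psiC polyC0 mulr0 add0r.
by rewrite -polyCM mulrA.
Qed.

(** Read from the right, every factor meets a vector on which it is a multiplication: alpha, beta,
    gamma are scalars, C acts on constants as [c] since [phi] kills them, B on A-free vectors as the
    inner variable, A as the outer one. *)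
Lemma act_pbw i j l r s t :
  act (pbw q (i, j, l, r, s, t)) 1 =
  'X ^+ i * ('X ^+ j * (c ^+ l * (al ^+ r * (be ^+ s * ga ^+ t)))%:P)%:P.
Proof.
rewrite /pbw; do 5 rewrite [LHS]actM.
rewrite (act_scalar_expr _ _ act_gamma) (act_scalar_expr _ _ act_beta).
rewrite (act_scalar_expr _ _ act_alpha) mulr1.
rewrite -(rmorphM cst (be ^+ s)) -(rmorphM cst (al ^+ r)).
rewrite [X in act _ (act _ X)]act_gC_expr [X in act _ X]act_gB_expr.
exact: act_gA_expr.
Qed.

End Action.

(** * Linear independence through coordinate functionals *)

Section DualFamily.
Variable F : fieldType.

(** Functionals dual to the family [m]: evaluating them on a linear combination recovers its
    coefficients, hence independence. *)
Definition dual_family (R : comNzRingType) (iota : F -> R) (I : eqType)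
    (m : I -> R) (co : I -> R -> F) :=
  [/\ forall i u v, co i (u + v) = co i u + co i v,
      forall i a u, co i (iota a * u) = a * co i u &
      forall i j, co i (m j) = (i == j)%:R].

(** To adjoin a variable, extract the coefficient of its power and then apply the old functional. *)
Lemma dual_family_poly (R : comNzRingType) (iota : F -> R) (I : eqType)
    (m : I -> R) (co : I -> R -> F) :
  dual_family iota m co ->
  dual_family (fun a => (iota a)%:P) (fun p : nat * I => 'X ^+ p.1 * (m p.2)%:P)
    (fun p (v : {poly R}) => co p.2 v`_p.1).
Proof.
case=> coD coZ com; split=> [[n i] u v|[n i] a u|[n i] [n' j]] /=.
- by rewrite coefD coD.
- by rewrite coefCM coZ.
have co0 : co i 0 = 0 by apply: (addrI (co i 0)); rewrite -coD !addr0.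
rewrite -pair_eqE /= coefXnM coefC subn_eq0; by case: ltngtP.
Qed.

Lemma eq_dual_family (R : comNzRingType) (iota iota' : F -> R) (I : eqType)
    (m m' : I -> R) (co : I -> R -> F) :
  iota =1 iota' -> m =1 m' -> dual_family iota m co -> dual_family iota' m' co.
Proof.
move=> ei em [coD coZ com]; split=> // [i a u|i j]; first by rewrite -ei.
by rewrite -em.
Qed.

Lemma dual_family_sum (R : comNzRingType) (iota : F -> R) (I : eqType)
    (m : I -> R) (co : I -> R -> F) (s : seq I) (e : I -> F) :
    dual_family iota m co -> uniq s ->
  forall i, i \in s -> co i (\sum_(j <- s) iota (e j) * m j) = e i.
Proof.
move=> [coD coZ com] us i si.
have co0 : co i 0 = 0 by apply: (addrI (co i 0)); rewrite -coD !addr0.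
rewrite (big_morph (co i) (coD i) co0) (bigD1_seq i) //= coZ com eqxx mulr1.
rewrite big1 ?addr0 // => j /negbTE ji.
by rewrite coZ com eq_sym ji mulr0.
Qed.

(** The ring is F[gamma][beta][alpha][c]. Each stage hides the previous ring behind an existential
    and adjoins one variable. *)
Lemma exists_dual_monomials :
  exists (R : comNzRingType) (iota : {rmorphism F -> R}) (c al be ga : R)
         (co : nat * (nat * (nat * nat)) -> R -> F),
    dual_family iota
      (fun e => c ^+ e.1 * (al ^+ e.2.1 * (be ^+ e.2.2.1 * ga ^+ e.2.2.2))) co.
Proof.
have [R [iota [ga [co co_dual]]]] : exists (R : comNzRingType) (iota : {rmorphism F -> R})
    (ga : R) (co : nat -> R -> F), dual_family iota (fun t => ga ^+ t) co.
  exists {poly F}, polyC, 'X, (fun t (p : {poly F}) => p`_t); split=> *.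
  - exact: coefD.
  - exact: coefCM.
  - by rewrite coefXn.
have {R iota ga co co_dual} [R [iota [be [ga [co co_dual]]]]] :
    exists (R : comNzRingType) (iota : {rmorphism F -> R})
    (be ga : R) (co : nat * nat -> R -> F), dual_family iota (fun e => be ^+ e.1 * ga ^+ e.2) co.
  exists {poly R}, (polyC \o iota), 'X, ga%:P, (fun p (v : {poly R}) => co p.2 v`_p.1).
  by apply: eq_dual_family (dual_family_poly co_dual) => // e; rewrite rmorphXn.
have {R iota be ga co co_dual} [R [iota [al [be [ga [co co_dual]]]]]] :
    exists (R : comNzRingType) (iota : {rmorphism F -> R})
    (al be ga : R) (co : nat * (nat * nat) -> R -> F),
    dual_family iota (fun e => al ^+ e.1 * (be ^+ e.2.1 * ga ^+ e.2.2)) co.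
  exists {poly R}, (polyC \o iota), 'X, be%:P, ga%:P, (fun p (v : {poly R}) => co p.2 v`_p.1).
  by apply: eq_dual_family (dual_family_poly co_dual) => // e; rewrite rmorphM !rmorphXn.
exists {poly R}, (polyC \o iota), 'X, al%:P, be%:P, ga%:P, (fun p (v : {poly R}) => co p.2 v`_p.1).
by apply: eq_dual_family (dual_family_poly co_dual) => // e; rewrite !rmorphM !rmorphXn.
Qed.

End DualFamily.

(** A combination lying in the ideal sends 1 to 0, while [act_pbw] turns its value at 1 into the
    same combination of distinct commutative monomials. *)
Lemma pbw_independent (F : fieldType) (q : F) (s : seq expo) (e : expo -> F) :
    q != 0 -> q ^+ 4 != 1 -> uniq s -> awIdeal q (\sum_(f <- s) e f *: pbw q f) ->
  forall f, f \in s -> e f = 0.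
Proof.
move=> hq0 hq4 us sJ f fs.
have [R [iota [c [al [be [ga [co co_dual]]]]]]] := exists_dual_monomials F.
(* The two further variables are B, then A, which yields functionals on V. *)
have := dual_family_poly (dual_family_poly co_dual).
set mon := (X in dual_family _ X _); set co2 := (X in dual_family _ _ X) => dual2.
(* [h] reassociates the left-nested exponents into the right-nested index of the dual family. *)
pose h (x : expo) := let: (i, j, l, r, s, t) := x in (i, (j, (l, (r, (s, t))))).
have h_inj : injective h.
  by move=> [[[[[i j] l] r] s'] t] [[[[[i' j'] l'] r'] s2] t'] [-> -> -> -> -> ->].
pose h' (x : nat * (nat * (nat * (nat * (nat * nat))))) : expo :=
  let: (i, (j, (l, (r, (s, t))))) := x in (i, j, l, r, s, t).
have hK : cancel h h' by move=> [[[[[i j] l] r] s'] t].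
have := act_awIdeal hq0 hq4 iota c al be ga 1 sJ.
have -> : act q iota c al be ga (\sum_(f <- s) e f *: pbw q f) 1 =
    \sum_(x <- map h s) (iota (e (h' x)))%:P%:P * mon x.
  rewrite big_map; elim: (s) => [|x s' IH]; first by rewrite !big_nil act0l.
  rewrite [RHS]big_cons [X in act _ _ _ _ _ _ X]big_cons -IH [LHS]actDl; congr (_ + _).
  rewrite [LHS]actZ hK; congr (_ * _).
  by case: x => [[[[[i j] l] r] s2] t]; rewrite act_pbw.
move=> h0; have := dual_family_sum (fun x => e (h' x)) dual2 _ (map_f h fs).
rewrite h0 hK => <-; last by rewrite map_inj_uniq.
by have [coD _ _] := dual2; apply: (addrI (co2 (h f) 0)); rewrite -coD !addr0.
Qed.

(** * Spanning by ordered monomials, for any relations of this shape *)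

Section Spanning.
Variables (F : fieldType) (R : lalgType F).
Variables (A B C al be ga : R) (J : R -> Prop).
Hypothesis scaleA : forall (a : F) (x y : R), a *: (x * y) = x * (a *: y).
Hypotheses (J0 : J 0) (JMl : forall x y, J y -> J (x * y)) (JMr : forall x y, J x -> J (x * y)).
Hypotheses (JD : forall x y, J x -> J y -> J (x + y)) (JZ : forall (a : F) x, J x -> J (a *: x)).
Hypotheses (al_central : forall x, J (al * x - x * al)) (be_central : forall x, J (be * x - x * be))
  (ga_central : forall x, J (ga * x - x * ga)).
Variables a1 a2 a3 b1 b2 b3 c1 c2 c3 : F.
Hypotheses (BA : B * A = a1 *: (A * B) + a2 *: C + a3 *: ga)
  (CA : C * A = b1 *: (A * C) + b2 *: B + b3 *: be)
  (CB : C * B = c1 *: (B * C) + c2 *: al + c3 *: A).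

Definition monomial (e : expo) : R :=
  let: (i, j, k, r, s, t) := e in
  A ^+ i * B ^+ j * C ^+ k * al ^+ r * be ^+ s * ga ^+ t.

(** The central elements have degree 0, so inserting them never raises the filtration. *)
Definition degree (e : expo) : nat := let: (i, j, k, _, _, _) := e in (i + j + k)%N.

(** Closure under congruence modulo [J] lets the argument stay in [R] without forming a quotient. *)
Inductive span_le (n : nat) : R -> Prop :=
| span_le0 : span_le n 0
| span_leD x y : span_le n x -> span_le n y -> span_le n (x + y)
| span_leZ (a : F) x : span_le n x -> span_le n (a *: x)
| span_le_cong x y : J (x - y) -> span_le n y -> span_le n x
| span_le_monomial e : (degree e <= n)%N -> span_le n (monomial e).

Lemma span_leW n m x : (n <= m)%N -> span_le n x -> span_le m x.
Proof.
move=> nm; elim=> [|y z _ hy _ hz|a y _ hy|y z yz _ hz|e he].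
- exact: span_le0.
- exact: span_leD.
- exact: span_leZ.
- exact: span_le_cong yz hz.
- by apply: span_le_monomial; apply: leq_trans nm.
Qed.

Lemma span_leM n m u :
    (forall e, (degree e <= n)%N -> span_le m (u * monomial e)) ->
  forall x, span_le n x -> span_le m (u * x).
Proof.
move=> hu x; elim=> [|y z _ hy _ hz|a y _ hy|y z yz _ hz|e he].
- by rewrite mulr0; exact: span_le0.
- by rewrite mulrDr; exact: span_leD.
- by rewrite -scaleA; exact: span_leZ.
- by apply: span_le_cong hz; rewrite -mulrBr; exact: JMl.
- exact: hu.
Qed.

Lemma span_leA n x : span_le n x -> span_le n.+1 (A * x).
Proof.
apply: span_leM => -[[[[[i j] k] r] s] t] /= h.
rewrite !mulrA -exprS.
by apply: (@span_le_monomial _ (i.+1, j, k, r, s, t)).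
Qed.

(** Centrality modulo [J] carries the new factor past A^i B^j C^k to its place. *)
Lemma span_le_al n x : span_le n x -> span_le n (al * x).
Proof.
apply: span_leM => -[[[[[i j] k] r] s] t] h.
apply: (@span_le_cong _ _ (monomial (i, j, k, r.+1, s, t))); last exact: span_le_monomial.
rewrite /= exprS !mulrA -!mulrBl; do 3 apply: JMr.
by have := al_central (A ^+ i * B ^+ j * C ^+ k); rewrite !mulrA.
Qed.

Lemma span_le_be n x : span_le n x -> span_le n (be * x).
Proof.
apply: span_leM => -[[[[[i j] k] r] s] t] h.
apply: (@span_le_cong _ _ (monomial (i, j, k, r, s.+1, t))); last exact: span_le_monomial.
rewrite /= exprS !mulrA -!mulrBl; do 2 apply: JMr.
by have := be_central (A ^+ i * B ^+ j * C ^+ k * al ^+ r); rewrite !mulrA.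
Qed.

Lemma span_le_ga n x : span_le n x -> span_le n (ga * x).
Proof.
apply: span_leM => -[[[[[i j] k] r] s] t] h.
apply: (@span_le_cong _ _ (monomial (i, j, k, r, s, t.+1))); last exact: span_le_monomial.
rewrite /= exprS !mulrA -!mulrBl; apply: JMr.
by have := ga_central (A ^+ i * B ^+ j * C ^+ k * al ^+ r * be ^+ s); rewrite !mulrA.
Qed.

Lemma monomialA i j k r s t :
  monomial (i.+1, j, k, r, s, t) = A * monomial (i, j, k, r, s, t).
Proof. by rewrite /= exprS !mulrA. Qed.

Lemma monomialB j k r s t :
  monomial (0%N, j.+1, k, r, s, t) = B * monomial (0%N, j, k, r, s, t).
Proof. by rewrite /= exprS !mul1r !mulrA. Qed.

Lemma monomialC k r s t :
  monomial (0%N, 0%N, k.+1, r, s, t) = C * monomial (0%N, 0%N, k, r, s, t).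
Proof. by rewrite /= exprS !mul1r !mulrA. Qed.

(** Strong induction on the degree. A leading A is pulled out by BA or CA, leaving B and C to act on
    a monomial of smaller degree. On A-free monomials B is immediate, and C passes a leading B by
    CB; hence B is settled before C in each degree. *)
Lemma span_leBC n :
  (forall x, span_le n x -> span_le n.+1 (B * x)) /\
  (forall x, span_le n x -> span_le n.+1 (C * x)).
Proof.
elim/ltn_ind: n => n IH.
have hB x : span_le n x -> span_le n.+1 (B * x).
  apply: span_leM => -[[[[[[|i] j] k] r] s] t] he.
    by rewrite -monomialB; apply: span_le_monomial; rewrite /= in he *; rewrite addSn.
  rewrite monomialA mulrA BA !mulrDl -!scalerAl -mulrA.
  (* The leading A forces [n] to be positive; the remaining monomial falls under the induction
     hypothesis one degree lower. *)
  case: n he IH => // n he IH; have [IHB IHC] := IH n (leqnn _).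
  have hm : span_le n (monomial (i, j, k, r, s, t)) by apply: span_le_monomial.
  apply: span_leD; first apply: span_leD; apply: span_leZ.
  - exact/span_leA/IHB.
  - exact/(span_leW (leqnSn _))/IHC.
  - exact/(span_leW (leqW (leqnSn _)))/span_le_ga.
split=> // x; apply: span_leM => -[[[[[[|i] j] k] r] s] t] he; last first.
  rewrite monomialA mulrA CA !mulrDl -!scalerAl -mulrA.
  case: n he IH {hB} => // n he IH; have [IHB IHC] := IH n (leqnn _).
  have hm : span_le n (monomial (i, j, k, r, s, t)) by apply: span_le_monomial.
  apply: span_leD; first apply: span_leD; apply: span_leZ.
  - exact/span_leA/IHC.
  - exact/(span_leW (leqnSn _))/IHB.
  - exact/(span_leW (leqW (leqnSn _)))/span_le_be.
case: j he => [|j] he; first by rewrite -monomialC; apply: span_le_monomial.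
rewrite monomialB mulrA CB !mulrDl -!scalerAl -mulrA.
case: n he IH hB => // n he IH hB; have [IHB IHC] := IH n (leqnn _).
have hm : span_le n (monomial (0%N, j, k, r, s, t)) by apply: span_le_monomial.
apply: span_leD; first apply: span_leD; apply: span_leZ.
(* B C m needs the bound for B in the current degree, not the induction hypothesis. *)
- exact/hB/IHC.
- exact/(span_leW (leqW (leqnSn _)))/span_le_al.
- exact/(span_leW (leqnSn _))/span_leA.
Qed.

(** A coefficient function cannot separate two occurrences of an exponent, so their weights are
    added. *)
Lemma sum_undup_coef (l : seq (F * expo)) :
  \sum_(p <- l) p.1 *: monomial p.2 =
  \sum_(e <- undup (map snd l)) (\sum_(p <- l | p.2 == e) p.1) *: monomial e.
Proof.
under [RHS]eq_bigr => e _ do rewrite scaler_suml.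
rewrite (exchange_big_dep xpredT) //= big_seq [RHS]big_seq; apply: eq_bigr => p pl.
rewrite big_mkcond (bigD1_seq p.2) ?undup_uniq ?mem_undup ?map_f //= eqxx.
by rewrite big1 ?addr0 // => e /negbTE; rewrite eq_sym => ->.
Qed.

Lemma span_le_sum n x : span_le n x ->
  exists (s : seq expo) (e : expo -> F), J (x - \sum_(f <- s) e f *: monomial f).
Proof.
suff: span_le n x -> exists l : seq (F * expo), J (x - \sum_(p <- l) p.1 *: monomial p.2).
  by move=> h /h [l]; rewrite sum_undup_coef => hl; do 2 eexists; exact: hl.
elim=> [|y z _ [l hl] _ [l' hl']|a y _ [l hl]|y z yz _ [l hl]|e he].
- by exists [::]; rewrite big_nil subr0.
- by exists (l ++ l'); rewrite big_cat opprD addrACA; exact: JD.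
- exists [seq (a * p.1, p.2) | p <- l]; rewrite big_map.
  under eq_bigr => p _ do rewrite -scalerA.
  by rewrite -scaler_sumr -scalerBr; exact: JZ.
- by exists l; rewrite -(subrK z y) -addrA; exact: JD.
- by exists [:: (1, e)]; rewrite big_seq1 scale1r subrr.
Qed.

End Spanning.

(** * Solving the definitions of alpha, beta, gamma for a product *)

Section Relations.
Variables (F : fieldType) (q : F) (R : lmodType F).
Hypotheses (hq0 : q != 0) (hq4 : q ^+ 4 != 1).
Variables x z w : R.

Local Notation k := (q ^+ 2 - q ^- 2).
Local Notation t := ((q + q^-1) *: (x + k^-1 *: (q *: z - q^-1 *: w))).

(** [t] has the shape of alpha, beta or gamma, with [z] and [w] in place of the two opposite
    products; the equation is linear in them, so a module suffices. *)
Lemma q_commutatorE : q *: z - q^-1 *: w = (k / (q + q^-1)) *: t - k *: x.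
Proof.
rewrite scalerA divfK ?q2D_neq0 // scalerDr scalerA divff ?q2B_neq0 //.
by rewrite scale1r addrAC subrr add0r.
Qed.

(** Serves BA and CB, which carry q^-1 in gamma and alpha; CA carries q in beta and takes
    [q_commutator_solvel]. *)
Lemma q_commutator_solver :
  w = q ^+ 2 *: z + (q * k) *: x - (q * (k / (q + q^-1))) *: t.
Proof.
rewrite -[(q * (k / _)) *: _]scalerA -[(q * k) *: x]scalerA -[RHS]addrA -scalerBr.
rewrite -[k *: x - _]opprB -q_commutatorE expr2 -scalerA -scalerDr opprB addrCA subrr addr0.
by rewrite scalerA divff // scale1r.
Qed.

Lemma q_commutator_solvel :
  z = q ^- 2 *: w - (q^-1 * k) *: x + (q^-1 * (k / (q + q^-1))) *: t.
Proof.
rewrite -[(q^-1 * (k / _)) *: _]scalerA -[(q^-1 * k) *: x]scalerA -addrA [- _ + _]addrC -scalerBr.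
rewrite -q_commutatorE -exprVn expr2 -scalerA -scalerDr addrCA subrr addr0.
by rewrite scalerA mulVf // scale1r.
Qed.

End Relations.

(** * The ideal, and centrality of alpha, beta, gamma modulo it *)

Section Ideal.
Variables (F : fieldType) (q : F).
Implicit Types x y : freeAlg F.

Lemma awIdeal0 : awIdeal q 0.
Proof. by exists [::]; rewrite big_nil. Qed.

Lemma awIdealD x y : awIdeal q x -> awIdeal q y -> awIdeal q (x + y).
Proof. by move=> [s ->] [s' ->]; exists (s ++ s'); rewrite big_cat. Qed.

Lemma awIdealMl x y : awIdeal q y -> awIdeal q (x * y).
Proof.
move=> [s ->]; exists [seq (x * t.1.1, t.1.2, t.2) | t <- s].
by rewrite big_map mulr_sumr; apply: eq_bigr => t _; rewrite -[RHS]mulrA -[RHS]mulrA -mulrA.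
Qed.

Lemma awIdealMr x y : awIdeal q x -> awIdeal q (x * y).
Proof.
move=> [s ->]; exists [seq (t.1.1, t.1.2, t.2 * y) | t <- s].
by rewrite big_map mulr_suml; apply: eq_bigr => t _; rewrite -[LHS]mulrA.
Qed.

Lemma awIdealZ (a : F) x : awIdeal q x -> awIdeal q (a *: x).
Proof. by move=> h; rewrite -[x]mul1r scalerAl; exact: awIdealMl. Qed.

Lemma awIdeal_relator i j : awIdeal q (relator q i j).
Proof. by exists [:: (1, (i, j), 1)]; rewrite big_seq1 mul1r mulr1. Qed.

Lemma commutator_mul (R : pzRingType) (u g x : R) :
  u * (g * x) - g * x * u = (u * g - g * u) * x + g * (u * x - x * u).
Proof. by rewrite mulrBl mulrBr !mulrA addrA subrK. Qed.

Lemma commutator_add (R : pzRingType) (u x y : R) :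
  u * (x + y) - (x + y) * u = (u * x - x * u) + (u * y - y * u).
Proof. by rewrite mulrDl mulrDr opprD addrACA. Qed.

(** The relators give commutation with generators only. The commutator with [u] is linear and obeys
    the Leibniz rule [commutator_mul], so membership in the ideal extends to all words. *)
Lemma awIdeal_central u (i : 'I_3) :
    (forall j, u * gen F j - gen F j * u = relator q i j) ->
  forall x, awIdeal q ((q + q^-1) *: u * x - x * ((q + q^-1) *: u)).
Proof.
move=> hu x; rewrite -scalerAl -freeAlg_scalerAr -scalerBr; apply: awIdealZ.
elim/freeAlg_ind: x => [x y hx hy|a x hx||j x hx].
- by rewrite commutator_add; exact: (awIdealD hx hy).
- suff -> : u * (a *: x) - a *: x * u = a *: (u * x - x * u) by exact: (awIdealZ a hx).
  by rewrite [RHS]scalerBr; congr (_ - _); [rewrite -freeAlg_scalerAr | rewrite -[LHS]scalerAl].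
- by rewrite mulr1 mul1r subrr; exact: awIdeal0.
rewrite commutator_mul; apply: awIdealD; last exact: (awIdealMl _ hx).
by apply: awIdealMr; rewrite hu; exact: awIdeal_relator.
Qed.

Lemma alpha_central x : awIdeal q (alpha q * x - x * alpha q).
Proof. exact: (@awIdeal_central _ (@Ordinal 3 0 isT)). Qed.

Lemma beta_central x : awIdeal q (beta q * x - x * beta q).
Proof. exact: (@awIdeal_central _ (@Ordinal 3 1 isT)). Qed.

Lemma gamma_central x : awIdeal q (gamma q * x - x * gamma q).
Proof. exact: (@awIdeal_central _ (@Ordinal 3 2 isT)). Qed.

End Ideal.

(** Every element is built from 1 by linear combinations and left multiplication by generators, each
    of which raises the filtration by at most one. *)
Lemma pbw_spans (F : fieldType) (q : F) (x : freeAlg F) :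
    q != 0 -> q ^+ 4 != 1 ->
  exists (s : seq expo) (e : expo -> F), awIdeal q (x - \sum_(f <- s) e f *: pbw q f).
Proof.
move=> hq0 hq4; pose k := q ^+ 2 - q ^- 2; pose m := k / (q + q^-1).
have scaleA := @freeAlg_scalerAr F.
(* The three relations hold in the free algebra itself, being the definitions of gamma, beta and
   alpha rearranged; the ideal enters through centrality. *)
have BA : gB F * gA F = q ^+ 2 *: (gA F * gB F) + (q * k) *: gC F + (- (q * m)) *: gamma q.
  by rewrite scaleNr; exact: q_commutator_solver.
have CA : gC F * gA F = q ^- 2 *: (gA F * gC F) + (- (q^-1 * k)) *: gB F
    + (q^-1 * m) *: beta q.
  by rewrite scaleNr; exact: q_commutator_solvel.
have CB : gC F * gB F = q ^+ 2 *: (gB F * gC F) + (- (q * m)) *: alpha q + (q * k) *: gA F.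
  by rewrite scaleNr addrAC; exact: q_commutator_solver.
pose J := awIdeal q.
pose span := @span_le F (freeAlg F) (gA F) (gB F) (gC F) (alpha q) (beta q) (gamma q) J.
have [hB hC] : (forall n y, span n y -> span n.+1 (gB F * y)) /\
    (forall n y, span n y -> span n.+1 (gC F * y)).
  have h n := span_leBC scaleA (@awIdealMl _ _) (@awIdealMr _ _) (@alpha_central _ _)
    (@beta_central _ _) (@gamma_central _ _) BA CA CB n.
  by split=> n; have [h1 h2] := h n; [exact: h1 | exact: h2].
have [n hx] : exists n, span n x.
  elim/freeAlg_ind: x => [x y [n hx] [p hy]|a x [n hx]||i x [n hx]].
  - exists (maxn n p); apply: span_leD.
      by apply: span_leW hx; rewrite leq_maxl.
    by apply: span_leW hy; rewrite leq_maxr.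
  - by exists n; exact: span_leZ.
  - exists 0%N; have := @span_le_monomial F _ (gA F) (gB F) (gC F) (alpha q) (beta q) (gamma q)
      J 0 (0%N, 0%N, 0%N, 0%N, 0%N, 0%N) (leqnn _).
    by rewrite /= !mul1r.
  exists n.+1; case: i => -[|[|[|//]]] hi.
  - rewrite (_ : Ordinal hi = Ordinal (isT : 0 < 3)%N); last exact: val_inj.
    exact: (span_leA scaleA (@awIdealMl _ _)).
  - rewrite (_ : Ordinal hi = Ordinal (isT : 1 < 3)%N); last exact: val_inj.
    exact: hB.
  - rewrite (_ : Ordinal hi = Ordinal (isT : 2 < 3)%N); last exact: val_inj.
    exact: hC.
(* At these generators [monomial] and [pbw] agree by unfolding. *)
exact: (span_le_sum (@awIdeal0 _ _) (@awIdealD _ _) (@awIdealZ _ _) hx).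
Qed.

(* The images in Delta = freeAlg F / awIdeal of the elements
   A^i B^j C^k alpha^r beta^s gamma^t form an F-basis of Delta:
   they span Delta, and they are linearly independent. *)
Theorem theorem4p1 (F : fieldType) (q : F) (hq0 : q != 0) (hq4 : q ^+ 4 != 1) :
  (forall x : freeAlg F, exists (S : seq expo) (c : expo -> F),
      awIdeal q (x - \sum_(e <- S) c e *: pbw q e)) /\
  (forall (S : seq expo) (c : expo -> F), uniq S ->
      awIdeal q (\sum_(e <- S) c e *: pbw q e) ->
      forall e, e \in S -> c e = 0).
Proof. by split=> [x|s e]; [exact: pbw_spans | exact: pbw_independent]. Qed.
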